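(* Let $\Omega\subseteq X_c^+$ be an arbitrary set, for each $\mathbf w\in\Omega$ choose a variable $z_{\mathbf w}\notin c(\mathbf w)$, and let $\mathcal V_\Omega$ be the subvariety of $\mathcal M$ defined within $\mathcal M$ by the identities $\mathbf w+z_{\mathbf w}\approx\mathbf w$ for all $\mathbf w\in\Omega$. The following conditions are equivalent: (i) $\mathcal V_\Omega$ is finitely based; (ii) some $\mathbf w\in\Omega$ has every variable occurring at most twice and at most one variable occurring twice; (iii) $\mathcal D\not\leq\mathcal V_\Omega$.
   Context: An additively idempotent semiring (ai-semiring) is an algebra $(S,+,\cdot)$ of signature $(2,2)$, without constants, such that $(S,+)$ is a commutative idempotent semigroup, $(S,\cdot)$ is a semigroup, and multiplication distributes over addition. All varieties are in the signature $(2,2)$; $\leq$ between varieties is inclusion. A variety is finitely based if it can be defined by finitely many identities. $\mathbf N$ is the ai-semiring on the nonnegative integers $\mathbb N_0$ whose semiring addition is $\max$ and whose semiring multiplication is numerical addition; $\mathcal M=\mathsf V(\mathbf N)$ is the variety it generates. $X$ is a countably infinite set of variables, $X_c^+$ is the free commutative semigroup on $X$ (nonempty commutative monomials, written multiplicatively), and $c(\mathbf w)$ is the set of variables occurring in $\mathbf w\in X_c^+$. $\mathcal D$ is the subvariety of $\mathcal M$ defined within $\mathcal M$ by the identities $x^3+z\approx x^3$ and $x^2y^2+z\approx x^2y^2$. *)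

(* Defs.v *)
From Stdlib Require List.
From mathcomp Require Import all_boot finmap multiset.

Set Implicit Arguments.
Unset Strict Implicit.
Unset Printing Implicit Defensive.

Local Open Scope fset_scope.
Local Open Scope mset_scope.
Local Open Scope nat_scope.

(** * Algebras of signature (2,2) *)

(* The carrier may be empty; the empty algebra satisfies every identity. *)
Record algebra := Algebra {
  carrier :> Type;
  add : carrier -> carrier -> carrier;
  mul : carrier -> carrier -> carrier
}.
Arguments add {a}.
Arguments mul {a}.

Definition ai_semiring (A : algebra) : Prop :=
  [/\ [/\ associative (@add A), commutative (@add A) & idempotent_op (@add A)],
      associative (@mul A),
      left_distributive (@mul A) add & right_distributive (@mul A) add].

Definition hom (A B : algebra) (f : A -> B) : Prop :=
  {morph f : x y / add x y} /\ {morph f : x y / mul x y}.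

Definition surjective (A B : Type) (f : A -> B) : Prop :=
  forall b, exists a, f a = b.

Definition prod_algebra (I : Type) (F : I -> algebra) : algebra :=
  @Algebra (forall i, F i) (fun f g i => add (f i) (g i))
                           (fun f g i => mul (f i) (g i)).

(** * Varieties *)

Definition class := algebra -> Prop.

Definition closed_under_images (K : class) : Prop :=
  forall (A B : algebra) (f : A -> B), hom f -> surjective f -> K A -> K B.

(* Subalgebras are taken up to isomorphism, that is, as embeddings. *)
Definition closed_under_subalgebras (K : class) : Prop :=
  forall (A B : algebra) (f : B -> A), hom f -> injective f -> K A -> K B.

Definition closed_under_products (K : class) : Prop :=
  forall (I : Type) (F : I -> algebra),
    (forall i, K (F i)) -> K (prod_algebra F).

Definition variety (K : class) : Prop :=
  [/\ closed_under_images K, closed_under_subalgebras K &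
      closed_under_products K].

Definition variety_gen (A : algebra) : class :=
  fun B => forall K : class, variety K -> K A -> K B.

Definition subvariety (V W : class) : Prop := forall A, V A -> W A.

(** * Identities *)

Definition X : choiceType := nat.

Inductive term :=
  | Var of X
  | Add of term & term
  | Mul of term & term.

Fixpoint eval (A : algebra) (v : X -> A) (t : term) : A :=
  match t with
  | Var x => v x
  | Add s t => add (eval v s) (eval v t)
  | Mul s t => mul (eval v s) (eval v t)
  end.

Definition identity : Type := (term * term)%type.

Definition satisfies (A : algebra) (e : identity) : Prop :=
  forall v : X -> A, eval v e.1 = eval v e.2.

Definition defined_within (V : class) (E : identity -> Prop) : class :=
  fun A => V A /\ forall e, E e -> satisfies A e.

Definition finitely_based (V : class) : Prop :=
  exists E : seq identity,
    forall A, V A <-> (forall e, List.In e E -> satisfies A e).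

(** * The semiring N and the variety M *)

Definition N : algebra := @Algebra nat maxn addn.

Definition M : class := variety_gen N.

Lemma ai_semiring_N : ai_semiring N.
Proof.
split; [split | | |].
- exact: maxnA.
- exact: maxnC.
- exact: maxnn.
- exact: addnA.
- by move=> x y z /=; rewrite addn_maxl.
- by move=> x y z /=; rewrite addn_maxr.
Qed.

(** * Commutative monomials *)

(* The free commutative semigroup on X, as nonempty finite multisets. *)
Definition monomial : Type := {w : {mset X} | w != mset0}.

Definition occ (x : X) (w : monomial) : nat := val w x.

Definition content (w : monomial) : {fset X} := finsupp (val w).

(* The variables of w are multiplied in an arbitrary fixed order, which is
   irrelevant in M. The branch for the empty sequence is never reached. *)
Definition term_of_monomial (w : monomial) : term :=
  if enum_mset (val w) is x :: s
  then foldl (fun t y => Mul t (Var y)) (Var x) s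
  else Var 0.

(* The subvariety of M defined by w + z_w = w for w in Omega. *)
Definition V_ (Omega : monomial -> Prop) (z : monomial -> X) : class :=
  defined_within M (fun e => exists2 w, Omega w &
    e = (Add (term_of_monomial w) (Var (z w)), term_of_monomial w)).

Definition D : class :=
  let x := Var 0 in let y := Var 1 in let z := Var 2 in
  let x3 := Mul (Mul x x) x in
  let x2y2 := Mul (Mul x x) (Mul y y) in
  defined_within M (fun e => e = (Add x3 z, x3) \/ e = (Add x2y2 z, x2y2)).

(* Main.v *)
From mathcomp Require Import all_boot finmap multiset boolp zify.
Require Import Defs.

(** In [N] a term is the maximum of its words, and a word takes the weight
    that a valuation gives to its letters. So [M] satisfies
    [m <= v_1 + ... + v_k] exactly when no valuation makes [m] weigh more than
    every [v_i]. An identity [w + z = w] with [z] fresh makes [w] a greatest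
    element, together with every multiple of an instance of [w]. Call a word
    heavy when it is a multiple of some [x^3] or [x^2 y^2] with [x <> y], the
    words that are greatest in [D]; the second condition says that [Omega]
    contains a word that is not heavy.

    If all words of [Omega] are heavy, then [D] lies in [V_ Omega]
    ([D_sub_V]). If some word is not, then it does not, because the identities
    of [D] whose words are not heavy already hold in [N]
    ([light_D_identity_N]): collapse the heavy part of an algebra of functions
    on valuations.

    Nothing between [D] and [M] is finitely based
    ([not_finitely_based_above_D]). Let [p = x_0 ... x_(n-1)], indices modulo
    [n], and let [r_j] be [p] with [x_(j+1)] exchanged for a second [x_j]. The
    inequality [p <= r_0 + ... + r_(n-1)] holds in [N], since [r_j] is as heavy
    as [p] when [x_j] has the largest weight. It cannot be derived from
    identities of [D] in fewer than [n] letters: an instance that produces [p]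
    from divisors of the [r_j] cuts [p] into a fixed context and fewer than [n]
    blocks. Some letter [x_(k+1)] lies in the context or shares its block with
    another letter, so [r_k], which lacks only [x_(k+1)], does not occur on the
    other side; but the other [r_j] do not suffice, because without [r_k] the
    cycle of exchanges breaks open and some weight increases along it
    ([separating_weight], [linear_instance_below_shift]). The algebra of terms
    modulo the contexts in which all words divide some [r_j] turns this into
    a model of the short identities outside [M].

    If [w] in [Omega] is not heavy and has length at most [n], then every
    longer word with a repeated letter is a multiple of an instance of [w],
    hence greatest ([light_divides_instance]). An inequality
    [m <= v_1 + ... + v_k] of [N] without such [v_i] is either witnessed by
    divisibility or, after erasing the letters outside [m], one of the
    finitely many inequalities in [n] letters with words of length at most [n].
    So the inequalities of [V_ Omega] in [n + 1] letters with words of length at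
    most [n + 1], one letter more to have room for [z <= w], form a basis
    together with the laws of commutative ai-semirings and [x <= x y].
    Birkhoff's theorem leads from the identities of [N] back to membership in
    [M] ([birkhoff], [finitely_based_V]). *)

Set Implicit Arguments.
Unset Strict Implicit.
Unset Printing Implicit Defensive.

(** * Terms as sums of words, and their values in N *)

Fixpoint mons (t : term) : seq (seq X) :=
  match t with
  | Var x => [:: [:: x]]
  | Add s t => mons s ++ mons t
  | Mul s t => [seq u ++ v | u <- mons s, v <- mons t]
  end.

Definition weight (f : X -> nat) (u : seq X) : nat := \sum_(x <- u) f x.

(** The inequality [s <= t] of the additive semilattice, as an identity. *)
Definition ineq (s t : term) : identity := (Add s t, t).

Lemma weight_cat f u v : weight f (u ++ v) = weight f u + weight f v.
Proof. by rewrite /weight big_cat. Qed.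

Lemma weight_cons f x u : weight f (x :: u) = f x + weight f u.
Proof. by rewrite /weight big_cons. Qed.

Lemma weight_nil f : weight f [::] = 0.
Proof. by rewrite /weight big_nil. Qed.

Lemma perm_weight f u v : perm_eq u v -> weight f u = weight f v.
Proof. by move=> uv; rewrite /weight (perm_big v). Qed.

Lemma mons_neq0 t : mons t != [::].
Proof.
elim: t => //= [s IHs t _|s IHs t IHt]; first by case: (mons s) IHs.
by case: (mons s) IHs => // u us _; case: (mons t) IHt.
Qed.

Lemma mons_word_neq0 t u : u \in mons t -> u != [::].
Proof.
elim: t u => [x|s IHs t IHt|s IHs t _] u /=.
- by rewrite inE => /eqP ->.
- by rewrite mem_cat => /orP[/IHs|/IHt].
- by case/allpairsP=> -[u1 u2] /= [/IHs + _ ->]; case: u1.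
Qed.

Lemma weight_le_eval f t u : u \in mons t -> weight f u <= eval (A := N) f t.
Proof.
elim: t u => [x|s IHs t IHt|s IHs t IHt] u /=.
- by rewrite inE => /eqP ->; rewrite weight_cons weight_nil addn0.
- by rewrite leq_max mem_cat => /orP[/IHs|/IHt] ->; rewrite ?orbT.
- case/allpairsP=> -[u1 u2] /= [/IHs le1 /IHt le2 ->].
  by rewrite weight_cat leq_add.
Qed.

Lemma eval_weight f t :
  exists2 u, u \in mons t & eval (A := N) f t = weight f u.
Proof.
elim: t => [x|s [u us Eu] t [v vt Ev]|s [u us Eu] t [v vt Ev]] /=.
- by exists [:: x]; rewrite ?inE // weight_cons weight_nil addn0.
- rewrite Eu Ev; case: (leqP (weight f u) (weight f v)) => _.
    by exists v; rewrite // mem_cat vt orbT.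
  by exists u; rewrite // mem_cat us.
- exists (u ++ v); last by rewrite weight_cat Eu Ev.
  by apply/allpairsP; exists (u, v).
Qed.

Lemma N_ineq s t :
  (forall f u, u \in mons s -> exists2 w, w \in mons t & weight f u <= weight f w) ->
  satisfies N (ineq s t).
Proof.
move=> st f /=; apply/maxn_idPr.
have [u us ->] := eval_weight f s; have [w wt le_uw] := st f u us.
exact: leq_trans le_uw (weight_le_eval f wt).
Qed.

Lemma eval_hom (A B : algebra) (f : A -> B) (v : X -> A) t :
  hom f -> f (eval v t) = eval (f \o v) t.
Proof.
move=> [fD fM].
by elim: t => //= s IHs t IHt; rewrite ?fD ?fM IHs IHt.
Qed.

Lemma eq_eval (A : algebra) (v w : X -> A) t : v =1 w -> eval v t = eval w t.
Proof. by move=> vw; elim: t => //= s -> t ->. Qed.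

Lemma eval_prod (I : Type) (F : I -> algebra) (v : X -> prod_algebra F) t i :
  eval v t i = eval (fun x => v x i) t.
Proof. by elim: t => //= s IHs t IHt; rewrite IHs IHt. Qed.

(** * The variety M: closure properties and identities *)

Lemma variety_models (E : identity -> Prop) :
  variety (fun A => forall e, E e -> satisfies A e).
Proof.
split.
- move=> A B f f_hom f_surj AE e /AE Ae v.
  pose w x := sval (cid (f_surj (v x))).
  have fw : f \o w =1 v by move=> x /=; rewrite /w; case: cid.
  by rewrite -!(eq_eval _ fw) -!eval_hom // Ae.
- move=> A B f f_hom f_inj AE e /AE Ae v.
  by apply: f_inj; rewrite !eval_hom.
- move=> I F FE e Ee v; apply: functional_extensionality_dep => i.
  by rewrite !eval_prod; apply: FE.
Qed.

(** The models of an identity form a variety, so this one contains [M] as soon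
    as it contains [N]. *)
Lemma M_satisfies A e : M A -> satisfies N e -> satisfies A e.
Proof.
move=> MA Ne.
have := MA _ (@variety_models (fun e' => satisfies N e')); apply=> //.
Qed.

Lemma M_variety : variety M.
Proof.
split.
- move=> A B f f_hom f_surj MA K varK KN; have [imK _ _] := varK.
  exact: imK f_hom f_surj (MA K varK KN).
- move=> A B f f_hom f_inj MA K varK KN; have [_ subK _] := varK.
  exact: subK f_hom f_inj (MA K varK KN).
- move=> I F MF K varK KN; have [_ _ prodK] := varK.
  by apply: prodK => i; apply: MF.
Qed.

Lemma N_in_M : M N.
Proof. by []. Qed.

(** * Quotients, subalgebras and Birkhoff's theorem for M *)

(** The carrier consists of one representative for each class; a classical choice
    made from the predicate [R a] depends only on the class of [a]. *)
Lemma quotient_exists (A : algebra) (R : A -> A -> Prop) :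
    (forall a, R a a) -> (forall a b, R a b -> R b a) ->
    (forall a b c, R a b -> R b c -> R a c) ->
    (forall a a' b b', R a a' -> R b b' -> R (add a b) (add a' b')) ->
    (forall a a' b b', R a a' -> R b b' -> R (mul a b) (mul a' b')) ->
  exists (B : algebra) (q : A -> B),
    [/\ hom q, surjective q & forall a b, q a = q b <-> R a b].
Proof.
move=> Rr Rs Rt RD RM.
pose rep a := sval (cid (ex_intro (R a) a (Rr a))).
have rep_cl a : R a (rep a) by rewrite /rep; case: cid.
have rep_eq a b : R a b -> rep a = rep b.
  move=> ab; rewrite /rep.
  have Eab : R a = R b.
    by apply/funext => c; apply/propext; split; apply: Rt => //; apply: Rs.
  by move: (ex_intro _ a _); rewrite Eab => p; rewrite (Prop_irrelevance p (ex_intro _ b (Rr b))).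
have repK a : rep (rep a) = rep a by apply/rep_eq/Rs.
pose q a : {a | rep a = a} := exist _ (rep a) (repK a).
have qE a b : q a = q b <-> R a b.
  split=> [[ab]|/rep_eq ab]; last exact: eq_exist.
  by apply: Rt (rep_cl a) _; rewrite ab; apply: Rs.
exists (@Algebra {a | rep a = a} (fun x y => q (add (sval x) (sval y)))
                               (fun x y => q (mul (sval x) (sval y)))), q.
split=> //; first by split=> a b /=; apply/qE; [apply: RD | apply: RM].
by case=> a Ea; exists a; apply: eq_exist.
Qed.

Lemma subalgebra_exists (A : algebra) (S : A -> Prop) :
    (forall a b, S a -> S b -> S (add a b)) ->
    (forall a b, S a -> S b -> S (mul a b)) ->
  exists (B : algebra) (i : B -> A),
    [/\ hom i, injective i, forall b, S (i b) & forall a, S a -> exists b, i b = a].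
Proof.
move=> SD SM.
exists (@Algebra {a | S a}
  (fun x y => exist _ (add (sval x) (sval y)) (SD _ _ (svalP x) (svalP y)))
  (fun x y => exist _ (mul (sval x) (sval y)) (SM _ _ (svalP x) (svalP y)))).
exists (fun x => sval x); split=> //.
- by move=> [a Sa] [b Sb] /= ab; apply: eq_exist.
- by move=> b; apply: svalP.
- by move=> a Sa; exists (exist _ a Sa).
Qed.

(** Terms over an arbitrary set of variables: Birkhoff's theorem evaluates terms
    whose variables are the elements of an algebra of any cardinality. *)
Inductive gterm (V : Type) :=
  | GVar of V
  | GAdd of gterm V & gterm V
  | GMul of gterm V & gterm V.

Fixpoint geval (V : Type) (A : algebra) (v : V -> A) (t : gterm V) : A :=
  match t with
  | GVar x => v x
  | GAdd s t => add (geval v s) (geval v t)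
  | GMul s t => mul (geval v s) (geval v t)
  end.

Fixpoint gvars (V : Type) (t : gterm V) : seq V :=
  match t with
  | GVar x => [:: x]
  | GAdd s t | GMul s t => gvars s ++ gvars t
  end.

Fixpoint relabel (V : Type) (enc : V -> X) (t : gterm V) : term :=
  match t with
  | GVar x => Var (enc x)
  | GAdd s t => Add (relabel enc s) (relabel enc t)
  | GMul s t => Mul (relabel enc s) (relabel enc t)
  end.

Lemma eval_relabel (V : Type) (A : algebra) (enc : V -> X) (v : X -> A) t :
  eval v (relabel enc t) = geval (v \o enc) t.
Proof. by elim: t => //= s -> t ->. Qed.

Lemma eq_in_geval (V : eqType) (A : algebra) (v w : V -> A) t :
  {in gvars t, v =1 w} -> geval v t = geval w t.
Proof.
elim: t => [x|s IHs t IHt|s IHs t IHt] /= vw; first by rewrite vw ?inE.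
all: rewrite IHs => [|x xs]; last by rewrite vw // mem_cat xs.
all: by rewrite IHt // => x xs; rewrite vw // mem_cat xs orbT.
Qed.

(** Only finitely many variables occur, so they can be renamed into [X]. *)
Lemma satisfies_gterm (V : Type) (A : algebra) (v : V -> A) (s t : gterm V) :
    (forall e, satisfies N e -> satisfies A e) ->
    (forall f : V -> N, geval f s = geval f t) ->
  geval v s = geval v t.
Proof.
move=> AN st.
have [x0 _] : exists x : V, True by elim: s {st} => // x; exists x.
pose L : seq {classic V} := gvars s ++ gvars t.
pose enc (x : V) : X := index (x : {classic V}) L.
pose dec (i : X) : V := nth (x0 : {classic V}) L i.
have encK : {in L, cancel enc dec} by move=> x xL; exact: (@nth_index {classic V} x0 x L xL).
have evalE r : {subset (gvars r : seq {classic V}) <= L} ->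
    geval v r = eval (v \o dec) (relabel enc r).
  move=> rL; rewrite eval_relabel.
  apply: (@eq_in_geval {classic V}) => x xr /=.
  by rewrite encK // rL.
rewrite !evalE; last 2 first.
- by move=> x xr; rewrite mem_cat xr orbT.
- by move=> x xr; rewrite mem_cat xr.
apply: (AN (relabel enc s, relabel enc t)) => f /=.
by rewrite !eval_relabel.
Qed.

(** [A] is a quotient of its term functions over [N]: these form a subalgebra of
    the power of [N] indexed by the valuations [A -> N], and sending the function
    of a term to the value of that term in [A] is well defined by the identities
    of [N]. *)
Theorem birkhoff (A : algebra) :
  (forall e, satisfies N e -> satisfies A e) -> M A.
Proof.
move=> AN; have [im_M sub_M prod_M] := M_variety.
pose P := @prod_algebra (A -> nat) (fun=> N).
pose S (p : P) := exists t : gterm A, forall f, p f = geval (A := N) f t.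
have [||B [i [i_hom i_inj iS Si]]] := @subalgebra_exists P S.
- by move=> p p' [t pt] [t' pt']; exists (GAdd t t') => f /=; rewrite pt pt'.
- by move=> p p' [t pt] [t' pt']; exists (GMul t t') => f /=; rewrite pt pt'.
have MB : M B by apply: sub_M i_hom i_inj (prod_M _ _ _) => _; apply: N_in_M.
pose h b : A := geval id (sval (cid (iS b))).
have hE b t : (forall f, i b f = geval (A := N) f t) -> h b = geval id t.
  move=> bt; rewrite /h; case: cid => t' bt' /=.
  by apply: satisfies_gterm => // f; rewrite -bt -bt'.
apply: (im_M B A h) => //.
  case: i_hom => iD iM; split=> b c; rewrite {2 3}/h.
    case: cid => s bs; case: cid => t ct /=.
    by rewrite (hE _ (GAdd s t)) // => f /=; rewrite -bs -ct iD.
  case: cid => s bs; case: cid => t ct /=.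
  by rewrite (hE _ (GMul s t)) // => f /=; rewrite -bs -ct iM.
move=> a; have [|b Eb] := Si (fun f => f a); first by exists (GVar a).
by exists b; rewrite (hE _ (GVar a)) // => f; rewrite Eb.
Qed.

(** * Heavy words and the identities of D *)

Definition mult (x : nat) (u : seq X) : nat := count_mem (x : X) u.

Lemma mult_nil x : mult x [::] = 0.
Proof. by []. Qed.

Lemma mult_cons x y u : mult x (y :: u) = (x == y :> nat) + mult x u.
Proof. by rewrite /mult /= eq_sym. Qed.

Lemma mult_cat x u v : mult x (u ++ v) = mult x u + mult x v.
Proof. exact: count_cat. Qed.

Lemma mult_gt0 x u : (0 < mult x u) = (x \in u).
Proof. by rewrite /mult -has_count has_pred1. Qed.

Lemma mult_uniq x u : uniq u -> mult x u = (x \in u).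
Proof. exact: count_uniq_mem. Qed.

Lemma perm_mult u v : perm_eq u v <-> forall x, mult x u = mult x v.
Proof.
split=> [/permP uv x|uv]; first exact: uv.
by apply/allP => x _; apply/eqP/uv.
Qed.

Definition heavy (u : seq X) : Prop :=
  (exists x : nat, 3 <= mult x u) \/
  (exists x y : nat, [/\ x <> y, 2 <= mult x u & 2 <= mult y u]).

Lemma weight_count2 a b (x y : nat) u :
  weight (fun i : nat => a * (i == x) + b * (i == y)) u =
  a * mult x u + b * mult y u.
Proof.
elim: u => [|z u IHu]; first by rewrite weight_nil /= !muln0.
by rewrite weight_cons IHu !mult_cons (eq_sym x) (eq_sym y) !mulnDr addnACA.
Qed.

Lemma weight_count (x : nat) u : weight (fun i : nat => i == x) u = mult x u.
Proof.
by elim: u => [|z u IHu]; rewrite ?weight_nil // weight_cons IHu mult_cons eq_sym.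
Qed.

(** The functions from valuations to [N] that lie above some projection form an
    algebra in [M]. Those above [3 x], or above [2 x + 2 y] with [x <> y], form an
    upward closed ideal; collapsing it to one point gives a member of [D], in
    which a term with no heavy word keeps its function. Lying above a projection
    is what forces cubes into the ideal. *)
Lemma light_D_identity_N e :
    (forall A, D A -> satisfies A e) ->
    (forall u, u \in mons e.1 -> ~ heavy u) ->
  satisfies N e.
Proof.
move=> De light; have [im_M sub_M prod_M] := M_variety.
pose P := @prod_algebra (X -> nat) (fun=> N).
pose S (F : P) := exists x : nat, forall f, f x <= F f.
pose top (F : P) := (exists x : nat, forall f, 3 * f x <= F f) \/
  (exists x y : nat, x <> y /\ forall f, 2 * f x + 2 * f y <= F f).
have top_mono (F G : P) : (forall f, F f <= G f) -> top F -> top G.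
  move=> FG [[x xF]|[x [y [xy xyF]]]]; [left; exists x | right; exists x, y; split=> //].
    by move=> f; apply: leq_trans (FG f).
  by move=> f; apply: leq_trans (FG f).
have [||B0 [i [i_hom i_inj iS Si]]] := @subalgebra_exists P S.
- by move=> F G [x xF] _; exists x => f; rewrite /= leq_max xF.
- by move=> F G [x xF] _; exists x => f; apply: leq_trans (xF f) (leq_addr _ _).
have [iD iM] := i_hom.
pose R b c := b = c \/ top (i b) /\ top (i c).
have [|||||B [q [q_hom q_surj qE]]] := @quotient_exists B0 R.
- by left.
- by move=> b c [->|[? ?]]; [left | right].
- by move=> a b c [->|[? ?]] [<-|[? ?]]; [left | right | right | right].
- move=> a a' b b' aa' bb'; case: (aa') => [->|[ta ta']]; last first.
    by right; rewrite !iD; split; [apply: top_mono ta | apply: top_mono ta'] => f /=; lia.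
  case: (bb') => [->|[tb tb']]; first by left.
  by right; rewrite !iD; split; [apply: top_mono tb | apply: top_mono tb'] => f /=; lia.
- move=> a a' b b' aa' bb'; case: (aa') => [->|[ta ta']]; last first.
    by right; rewrite !iM; split; [apply: top_mono ta | apply: top_mono ta'] => f /=; lia.
  case: (bb') => [->|[tb tb']]; first by left.
  by right; rewrite !iM; split; [apply: top_mono tb | apply: top_mono tb'] => f /=; lia.
have [qD qM] := q_hom.
have DB : D B.
  split.
    apply: (im_M _ _ q) => //; apply: sub_M i_hom i_inj _.
    by apply: prod_M => _; apply: N_in_M.
  move=> e' De' v; have [b0 b0E] := q_surj (v 0).
  have [b1 b1E] := q_surj (v 1); have [b2 b2E] := q_surj (v 2).
  have [x xb0] := iS b0; have [y yb1] := iS b1.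
  case: De' => -> /=; rewrite -b0E -?b1E -b2E -?qM -qD; apply/qE; right;
    rewrite !iD !iM.
    by split; left; exists x => f /=; have := xb0 f; lia.
  have [xy|/eqP xy] := eqVneq x y.
    by subst y; split; left; exists x => f /=; have := xb0 f; have := yb1 f; lia.
  by split; right; exists x, y; split=> // f /=; have := xb0 f; have := yb1 f; lia.
have /choice[p pE] (x : X) : exists b, i b = fun f => f x by apply: Si; exists x.
have ipE t f : i (eval p t) f = eval (A := N) f t.
  rewrite eval_hom // eval_prod; apply: eq_eval => x /=.
  by rewrite pE.
have := De B DB (q \o p); rewrite -!eval_hom // => /qE[Ee f|[e_top _]].
  by rewrite -!ipE Ee.
case: e_top => [[x xE]|[x [y [xy xyE]]]].
  have := xE (fun z : nat => z == x); rewrite ipE.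
  have [u ue ->] := eval_weight (fun z : nat => z == x : nat) e.1.
  rewrite weight_count eqxx => c3; case: (light u ue); left; exists x; lia.
have := xyE (fun z : nat => 1 * (z == x) + 1 * (z == y)); rewrite ipE.
have [u ue ->] := eval_weight (fun z : nat => 1 * (z == x) + 1 * (z == y)) e.1.
rewrite weight_count2 !eqxx => c4; case: (light u ue).
case: (ltnP 2 (mult x u)) => [c3|cx]; first by left; exists x.
case: (ltnP 2 (mult y u)) => [c3|cy]; first by left; exists y.
by right; exists x, y; split=> //; lia.
Qed.

(** * Divisors of the words obtained by a cyclic exchange *)

Definition divides (u v : seq X) : Prop :=
  forall x : nat, mult x u <= mult x v.

Lemma dividesP u v : divides u v <-> exists c, perm_eq (u ++ c) v.
Proof.
split=> [|[c /perm_mult uc] x]; last by rewrite -uc mult_cat leq_addr.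
elim: u v => [|x u IHu] v uv; first by exists v.
have xv : x \in v by rewrite -mult_gt0; apply: leq_trans (uv x); rewrite mult_cons eqxx.
have [y|c uc] := IHu (rem x v).
  have := uv y; have /perm_mult/(_ y) := perm_to_rem xv.
  by rewrite !mult_cons => ->; rewrite leq_add2l.
by exists c; rewrite perm_sym (perm_trans (perm_to_rem xv)) // perm_cons perm_sym.
Qed.

Lemma divides_trans u v w : divides u v -> divides v w -> divides u w.
Proof. by move=> uv vw x; apply: leq_trans (vw x). Qed.

Lemma divides_weight f u v : divides u v -> weight f u <= weight f v.
Proof.
by case/dividesP=> c /(perm_weight f) <-; rewrite weight_cat leq_addr.
Qed.

Lemma heavy_divides u v : divides u v -> heavy u -> heavy v.
Proof.
move=> uv [[x x3]|[x [y [xy x2 y2]]]]; [left; exists x | right; exists x, y; split=> //].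
all: by apply: leq_trans (uv _).
Qed.

Lemma divides_filter (P : pred X) u : divides (filter P u) u.
Proof. by move=> x; rewrite /mult count_filter; apply: sub_count => y /andP[]. Qed.

Definition cyclic_next (n j : nat) : nat := if j.+1 == n then 0 else j.+1.

(** The word [r_j]: one more [j] and no successor of [j]. *)
Definition shift (n j : nat) : seq X := j :: rem (cyclic_next n j) (iota 0 n).

Lemma cyclic_next_lt n j : j < n -> cyclic_next n j < n.
Proof. rewrite /cyclic_next; case: eqP; lia. Qed.

Lemma perm_cyclic_next_shift n j : j < n ->
  perm_eq (cyclic_next n j :: shift n j) (j :: iota 0 n).
Proof.
move=> jn; have next_iota : cyclic_next n j \in iota 0 n by rewrite mem_iota cyclic_next_lt.
apply/permP => P; have /permP/(_ P) := perm_to_rem next_iota.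
by rewrite /= => ->; rewrite addnCA.
Qed.

Lemma cyclic_next_neq n j : 1 < n -> cyclic_next n j != j.
Proof. by rewrite /cyclic_next; case: (j.+1 =P n); lia. Qed.

Lemma cyclic_next_surj n y : y < n -> exists2 j, j < n & cyclic_next n j = y.
Proof.
case: y => [|j] jn; last by exists j; rewrite /cyclic_next; [lia | case: eqP; lia].
by exists n.-1; rewrite /cyclic_next ?prednK ?eqxx; lia.
Qed.

Lemma mult_iota n x : mult x (iota 0 n) = (x < n).
Proof. by rewrite mult_uniq ?iota_uniq // mem_iota. Qed.

Lemma mult_shift n j x : j < n ->
  (x == cyclic_next n j) + mult x (shift n j) = (x == j) + (x < n).
Proof. by move/perm_cyclic_next_shift/perm_mult/(_ x); rewrite !mult_cons mult_iota. Qed.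

Lemma weight_shift f n j : j < n ->
  f (cyclic_next n j) + weight f (shift n j) = f j + weight f (iota 0 n).
Proof.
by move/perm_cyclic_next_shift; move: (shift n j) => s /(perm_weight f); rewrite !weight_cons.
Qed.

Definition below_shift (n : nat) (u : seq X) : Prop :=
  exists2 j, j < n & divides u (shift n j).

Lemma below_shift_divides n u v : divides u v -> below_shift n v -> below_shift n u.
Proof. by move=> uv [j jn vj]; exists j => //; apply: divides_trans vj. Qed.

Lemma below_shift_light n u : below_shift n u -> ~ heavy u.
Proof.
case=> j jn uj; case=> [[x x3]|[x [y [xy x2 y2]]]].
  have := uj x; have := mult_shift x jn; lia.
have := uj x; have := mult_shift x jn; have := uj y; have := mult_shift y jn.
lia.
Qed.

(** Weights on one or two letters already exclude all other words: they forbid a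
    third occurrence of a letter, two double letters, and a double letter followed
    by its successor. *)
Lemma hull_of_shifts n q : 1 < n ->
    (forall f, exists2 u, below_shift n u & weight f q <= weight f u) ->
  below_shift n q \/ perm_eq q (iota 0 n).
Proof.
move=> n1 qP.
have q2 (a b x y : nat) : exists2 j, j < n &
    a * mult x q + b * mult y q <=
    a * mult x (shift n j) + b * mult y (shift n j).
  have [u [j jn /divides_weight uj]] := qP (fun i : nat => a * (i == x) + b * (i == y)).
  by have := uj (fun i : nat => a * (i == x) + b * (i == y));
    rewrite !weight_count2 => /[swap]; exists j => //; lia.
have q1 x : mult x q <= (x < n).*2.
  have [j jn] := q2 1 0 x x; have := mult_shift x jn; lia.
have [[h h2]|no2] := pselect (exists h : nat, 2 <= mult h q).
  have hn : h < n by have := q1 h; lia.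
  left; exists h => // y.
  have := mult_shift y hn; have [->|yh] := eqVneq y h.
    by have := q1 h; have := cyclic_next_neq h n1; lia.
  have [yn|yn] := eqVneq y (cyclic_next n h).
    have [j jn] := q2 2 1 h y; have := cyclic_next_neq h n1.
    by have := mult_shift h jn; have := mult_shift y jn; have [->|jh] := eqVneq j h; lia.
  have [j jn] := q2 1 1 h y.
  by have := mult_shift h jn; have := mult_shift y jn; lia.
have qlin x : mult x q <= (x < n).
  have := q1 x; case: (ltnP 1 (mult x q)) => [x2|]; last lia.
  by case: no2; exists x.
have [qn|] := pselect (exists2 y : nat, y < n & y \notin q).
  have [y yn yq] := qn; left; rewrite -mult_gt0 in yq.
  have [j jn Ey] := cyclic_next_surj yn.
  exists j => // x; have := mult_shift x jn; rewrite Ey.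
  have := qlin x; have [->|] := eqVneq x y; lia.
move=> qfull; right; apply/perm_mult => x; rewrite mult_iota.
have := qlin x; case: (ltnP x n) => xn; last lia.
suff : x \in q by rewrite -mult_gt0; lia.
by apply/negPn/negP => xq; case: qfull; exists x.
Qed.

(** Removing the exchange at [k] from the cycle leaves a path, along which [f]
    increases by one at each step; hence each remaining exchanged word is lighter
    than the product of all letters. The exchange at [k] adds only [n - 1], and
    all weights are at least [n], so the proper divisors of [shift n k] are lighter
    as well. *)
Lemma separating_weight n k : 1 < n -> k < n -> exists f, forall u,
  below_shift n u -> ~ perm_eq u (shift n k) -> weight f u < weight f (iota 0 n).
Proof.
move=> n1 kn; pose f (x : nat) := n + x + n * (x <= k).
exists f => u [j jn /dividesP[c uc]] u_neq.
have := weight_shift f jn.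
rewrite -(perm_weight f uc) weight_cat.
have [jk|jk] := eqVneq j k; last first.
  suff : f j < f (cyclic_next n j) by lia.
  rewrite /f /cyclic_next; case: (j.+1 =P n) => jn1.
    by rewrite leq0n; case: (leqP j k); lia.
  by case: (leqP j k); case: (leqP j.+1 k); lia.
subst j; case: c uc => [|x c] uc; first by case: u_neq; rewrite -[u]cats0.
suff : f k < f (cyclic_next n k) + f x by rewrite weight_cons; lia.
rewrite /f /cyclic_next leqnn; case: (k.+1 =P n) => kn1; first by rewrite leq0n; lia.
by rewrite ltnn; lia.
Qed.

Lemma weight_flatten f (g : X -> seq X) v :
  weight f (flatten (map g v)) = weight (fun x => weight f (g x)) v.
Proof.
elim: v => [|x v IHv]; first by rewrite /= !weight_nil.
by rewrite /= weight_cat weight_cons IHv.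
Qed.

Lemma mult_flatten (g : X -> seq X) x v :
  mult x (flatten (map g v)) = weight (fun y => mult x (g y)) v.
Proof.
elim: v => [|y v IHv]; first by rewrite weight_nil.
by rewrite /= mult_cat weight_cons IHv.
Qed.

Lemma divides_filter_flatten (g : X -> seq X) a v P :
  divides (a ++ flatten (map g (filter P v))) (a ++ flatten (map g v)).
Proof.
move=> x; rewrite !mult_cat leq_add2l.
elim: v => //= y v IHv; case: (P y) => /=; rewrite !mult_cat.
  by rewrite leq_add2l.
by apply: leq_trans IHv (leq_addl _ _).
Qed.

(** The words [g x] for [x] in [m], together with [a], are the blocks of the
    instance of [m]. By [hull_of_shifts] it is a divisor of an exchanged word or
    the full product. In the second case [separating_weight] shows that every
    [shift n k] is an instance of some [v], restricted to the letters of [m]. As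
    [shift n k] contains every letter but the successor of [k], this successor is
    not in [a] and shares its block with no other letter. For all [k] together this
    takes [n] blocks. *)
Lemma linear_instance_below_shift n a m (g : X -> seq X) (V : seq (seq X)) :
    1 < n -> uniq m -> size m < n -> (forall x, g x <> [::]) ->
    (forall v, v \in V -> below_shift n (a ++ flatten (map g v))) ->
    (forall f, exists2 v, v \in V & weight f m <= weight f v) ->
  below_shift n (a ++ flatten (map g m)).
Proof.
move=> n1 m_uniq m_lt g0 VQ mV.
pose r v := a ++ flatten (map g (filter (mem m) v)).
have rQ v : v \in V -> below_shift n (r v).
  by move/VQ; apply: below_shift_divides; apply: divides_filter_flatten.
have hullV f : exists2 v, v \in V & weight f (a ++ flatten (map g m)) <= weight f (r v).
  have [v vV mv] := mV (fun x => if x \in m then weight f (g x) else 0).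
  exists v => //; rewrite !weight_cat !weight_flatten leq_add2l.
  rewrite [weight _ (filter _ _)]/weight big_filter big_mkcond /=.
  apply: leq_trans mv; rewrite leq_eqVlt; apply/orP; left; apply/eqP.
  by apply: eq_big_seq => x ->.
have [f|//|full] := @hull_of_shifts n (a ++ flatten (map g m)) n1.
  by have [v vV mv] := hullV f; exists (r v) => //; apply: rQ.
(* Some exchanged word is no instance: it can be left out of the cycle. *)
have [[k [kn kV]]|none] :=
  pselect (exists k, k < n /\ forall v, v \in V -> ~ perm_eq (r v) (shift n k)).
  have [f fP] := separating_weight n1 kn.
  have [v vV] := hullV f; rewrite (perm_weight f full) leqNgt fP //.
  - exact: rQ.
  - exact: kV.
have hit y : y < n -> exists2 v, v \in V & forall x, (x \in r v) = (x < n) && (x != y).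
  move=> /cyclic_next_surj[k kn Ey].
  have [v vV vk] : exists2 v, v \in V & perm_eq (r v) (shift n k).
    apply: contrapT => no_v; case: none; exists k; split=> // v vV vk.
    by case: no_v; exists v.
  exists v => // x; rewrite (perm_mem vk) -mult_gt0.
  have := mult_shift x kn; have := cyclic_next_neq k n1; rewrite Ey.
  by have [->|xk] := eqVneq x k; have [xy|xy] := eqVneq x y; lia.
have in_full x : x \in a ++ flatten (map g m) -> x < n.
  by rewrite (perm_mem full) mem_iota add0n.
have a0 : a = [::].
  case Ea: a => [//|y a']; have ya : y \in a by rewrite Ea inE eqxx.
  have [|v _ vE] := hit y; first by rewrite in_full // mem_cat ya.
  by have := vE y; rewrite eqxx andbF mem_cat ya.
subst a.
have once x : mult x (flatten (map g m)) <= 1.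
  by have /perm_mult/(_ x) := full; rewrite mult_iota /= => ->; apply: leq_b1.
have mem_flat x y v : y \in v -> x \in g y -> x \in flatten (map g v).
  by move=> yv xgy; apply/flatten_mapP; exists y.
have g1 y : y \in m -> size (g y) = 1.
  move=> ym; case E: (g y) => [|c s]; first by case: (g0 y).
  have cy : c \in g y by rewrite E inE eqxx.
  have [v _ vE] := hit c (in_full c (mem_flat c y m ym cy)).
  have yv : y \notin filter (mem m) v.
    apply/negP => yv; have := vE c; rewrite eqxx andbF => /negP[].
    exact: mem_flat yv cy.
  have gy_c : all (pred1 c) (g y).
    apply/allP => c' c'g /=; apply/negPn/negP => c'c.
    have /flatten_mapP[y' y'v c'g'] : c' \in flatten (map g (filter (mem m) v)).
      by move: (vE c'); rewrite c'c in_full ?(mem_flat c' y m) ?ym ?c'g // => E; exact: E.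
    have y'y : y' != y by apply: contraNneq yv => <-.
    have y'm : y' \in m by move: y'v; rewrite mem_filter => /andP[].
    have := once c'; rewrite leqNgt => /negP[].
    rewrite mult_flatten.
    have yy'm : divides [:: y; y'] m.
      move=> z; rewrite !mult_cons (mult_uniq _ m_uniq).
      have [->|zy] := eqVneq z y; first by rewrite ym eq_sym (negPf y'y).
      by have [->|] := eqVneq z y'; rewrite ?y'm.
    apply: leq_trans (divides_weight _ yy'm).
    rewrite !weight_cons weight_nil addn0.
    by rewrite -add1n leq_add // mult_gt0.
  apply/eqP; rewrite -E eqn_leq; apply/andP; split; last by rewrite E.
  move: gy_c; rewrite all_count => /eqP <-; apply: leq_trans (once c).
  rewrite mult_flatten; have ym1 : divides [:: y] m.
    by move=> z; rewrite mult_cons (mult_uniq _ m_uniq); have [->|] := eqVneq z y; rewrite ?ym.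
  apply: leq_trans (divides_weight _ ym1).
  by rewrite weight_cons weight_nil addn0.
have full_size : size (flatten (map g m)) = n by rewrite (perm_size full) size_iota.
suff Esize : size (flatten (map g m)) = size m by rewrite -full_size Esize ltnn in m_lt.
have sizeE u : size u = weight (fun=> 1) u by rewrite /weight sum1_size.
rewrite !sizeE weight_flatten; apply: eq_big_seq => y ym.
by rewrite -sizeE g1.
Qed.

(** * Substitution on words *)

Definition term_of_word (u : seq X) : term :=
  if u is x :: s then foldl (fun t y => Mul t (Var y)) (Var x) s else Var 0.

Definition term_of_words (P : seq (seq X)) : term :=
  if P is u :: P then foldl (fun t v => Add t (term_of_word v)) (term_of_word u) P
  else Var 0.

Lemma mons_term_of_word u : u != [::] -> mons (term_of_word u) = [:: u].
Proof.
case: u => // x s _; rewrite /term_of_word -[x :: s]/([:: x] ++ s).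
have: mons (Var x) = [:: [:: x]] by [].
move: (Var x) [:: x] => t u; elim: s t u => [|y s IHs] t u tu /=.
  by rewrite cats0.
by rewrite (IHs _ (rcons u y)) ?cat_rcons //= tu /= cats1.
Qed.

Lemma mons_term_of_words P : P != [::] -> [::] \notin P -> mons (term_of_words P) = P.
Proof.
case: P => // u P _; rewrite inE negb_or eq_sym => /andP[u0 P0] /=.
rewrite -[u :: P]/([:: u] ++ P); have: mons (term_of_word u) = [:: u].
  exact: mons_term_of_word.
move: (term_of_word u) [:: u] => t Q.
elim: P P0 t Q => [|v P IHP] P0 t Q tQ /=; first by rewrite cats0.
move: P0; rewrite inE negb_or eq_sym => /andP[v0 P0].
by rewrite (IHP P0 _ (rcons Q v)) ?cat_rcons //= tQ mons_term_of_word // cats1.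
Qed.

Definition term_algebra : algebra := Algebra Add Mul.

Definition subst (g : X -> term) (t : term) : term := eval (A := term_algebra) g t.

(** A word of an instance of [t] chooses a word of [g x] for each occurrence of
    [x], possibly different words for different occurrences; [z] records the
    choices. *)
Lemma mons_subst g t u : u \in mons (subst g t) <->
  exists z : seq (X * seq X),
    [/\ unzip1 z \in mons t, {in z, forall p, p.2 \in mons (g p.1)} &
        u = flatten (unzip2 z)].
Proof.
elim: t u => [x|s IHs t IHt|s IHs t IHt] u /=.
- split=> [ux|[z [zx zP ->]]].
    by exists [:: (x, u)]; rewrite /= inE cats0; split=> // p; rewrite inE => /eqP->.
  move: zx; rewrite inE; move/eqP; case: z zP => [|p [|? ?]] //= zP [px] //.
  by rewrite cats0 -px zP // inE.
- rewrite mem_cat.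
  split=> [/orP[/IHs|/IHt]|] [z [zt zP ->]].
  + by exists z; rewrite mem_cat zt.
  + by exists z; rewrite mem_cat zt orbT.
  by move: zt; rewrite mem_cat => /orP[zt|zt]; apply/orP;
    [left; apply/IHs | right; apply/IHt]; exists z.
- split=> [/allpairsP[[u1 u2] /= [/IHs[z1 [z1s z1P ->]] /IHt[z2 [z2t z2P ->]] ->]]|].
    exists (z1 ++ z2); rewrite /unzip1 /unzip2 !map_cat flatten_cat; split=> //.
      by apply/allpairsP; exists (unzip1 z1, unzip1 z2).
    by move=> p; rewrite mem_cat => /orP[/z1P|/z2P].
  case=> z [/allpairsP[[v1 v2] /= [v1s v2t zE]] zP ->].
  rewrite -(cat_take_drop (size v1) z) /unzip2 map_cat flatten_cat.
  apply/allpairsP; eexists (_, _) => /=; split; last by [].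
    apply/IHs; exists (take (size v1) z); split=> //.
      by rewrite /unzip1 map_take -/(unzip1 z) zE take_size_cat.
    by move=> p /mem_take/zP.
  apply/IHt; exists (drop (size v1) z); split=> //.
    by rewrite /unzip1 map_drop -/(unzip1 z) zE drop_size_cat.
  by move=> p /mem_drop/zP.
Qed.

Lemma mons_subst_map g (h : X -> seq X) t v :
  v \in mons t -> (forall x, h x \in mons (g x)) ->
  flatten (map h v) \in mons (subst g t).
Proof.
move=> vt hg; apply/mons_subst; exists [seq (x, h x) | x <- v].
rewrite /unzip1 /unzip2 -!map_comp map_id; split=> // p /mapP[x _ ->].
exact: hg.
Qed.

Lemma perm_map_lift (T U : eqType) (f : T -> U) s t :
  perm_eq (map f s) t -> exists2 s', perm_eq s s' & map f s' = t.
Proof.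
case: s => [|x0 s0]; first by rewrite perm_sym => /perm_nilP->; exists [::].
set s := x0 :: s0; rewrite perm_sym => /(perm_iotaP (f x0)); rewrite size_map.
case=> I I_perm ->; exists [seq nth x0 s i | i <- I].
  rewrite perm_sym -[X in perm_eq _ X](mkseq_nth x0) /mkseq.
  exact: perm_map.
rewrite -map_comp; apply/eq_in_map => i.
rewrite (perm_mem I_perm) mem_iota /= => iI.
by rewrite -[RHS]/(nth (f x0) (map f s) i) (nth_map x0).
Qed.

Lemma choose_mons (g : X -> term) : exists h : X -> seq X, forall x, h x \in mons (g x).
Proof.
exists (fun x => head [::] (mons (g x))) => x.
by case: (mons (g x)) (mons_neq0 (g x)) => // y l; rewrite inE eqxx.
Qed.

Lemma mons_subst_divides g s (z : seq (X * seq X)) v :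
    v \in mons s -> divides (unzip1 z) v ->
    {in z, forall p, p.2 \in mons (g p.1)} ->
  exists2 w, w \in mons (subst g s) & divides (flatten (unzip2 z)) w.
Proof.
move=> vs /dividesP[c zcv] zP.
have [h hg] := choose_mons g.
pose z' := z ++ [seq (x, h x) | x <- c].
have z'E : unzip1 z' = unzip1 z ++ c.
  by rewrite /unzip1 map_cat -map_comp map_id.
have [] := @perm_map_lift _ _ fst z' v; first by rewrite -/(unzip1 z') z'E.
move=> z'' z'z'' z''v; exists (flatten (unzip2 z'')).
  apply/mons_subst; exists z''; rewrite /unzip1 z''v; split=> // p.
  rewrite -(perm_mem z'z'') mem_cat => /orP[/zP //|/mapP[x _ ->]]; exact: hg.
have /perm_flatten/perm_mult pE : perm_eq (unzip2 z') (unzip2 z'') by apply: perm_map.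
move=> x; rewrite -pE /z' /unzip2 map_cat flatten_cat mult_cat; exact: leq_addr.
Qed.


Lemma heavy_flatten (h : X -> seq X) u :
  (forall x, h x != [::]) -> heavy u -> heavy (flatten (map h u)).
Proof.
move=> h0; have h1 x : mult (head 0 (h x)) (h x) > 0.
  by rewrite mult_gt0; case: (h x) (h0 x) => // y l; rewrite inE eqxx.
have le_weight (f f' : X -> nat) : (forall x, f x <= f' x) -> weight f u <= weight f' u.
  by move=> ff'; apply: leq_sum => x _.
case=> [[x x3]|[x [y [xy x2 y2]]]].
  left; exists (head 0 (h x)); rewrite mult_flatten; apply: leq_trans x3 _.
  rewrite -weight_count; apply: le_weight => z.
  by have [->|] := eqVneq z x.
have [hxy|hxy] := eqVneq (head 0 (h x) : nat) (head 0 (h y)).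
  left; exists (head 0 (h x)); rewrite mult_flatten.
  apply: (@leq_trans (1 * mult x u + 1 * mult y u)); first by lia.
  rewrite -weight_count2; apply: le_weight => z; have := h1 z.
  have [->|zx] := eqVneq (z : nat) x; first by have /eqP/negPf -> := xy.
  by have [->|] := eqVneq (z : nat) y; rewrite ?hxy.
right; exists (head 0 (h x)), (head 0 (h y)); split; first exact/eqP.
  rewrite mult_flatten; apply: leq_trans x2 _.
  by rewrite -weight_count; apply: le_weight => z; have [->|] := eqVneq z x.
rewrite mult_flatten; apply: leq_trans y2 _.
by rewrite -weight_count; apply: le_weight => z; have [->|] := eqVneq z y.
Qed.

(** Let [y] occur twice in [m]. A large weight on [y] selects a [v] in which [y]
    occurs twice; as [v] is not heavy, its other letters are simple, so that the
    weight 1 on each letter of [m] leaves no room but for [m] to divide [v]. *)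
Lemma nonlinear_divides (V : seq (seq X)) m :
    ~~ uniq m -> (forall v, v \in V -> ~ heavy v) ->
    (forall f, exists2 v, v \in V & weight f m <= weight f v) ->
  exists2 v, v \in V & divides m v.
Proof.
move=> m_nuniq light mV.
have [y y2] : exists y : nat, 2 <= mult y m.
  apply: contrapT => no; case/negP: m_nuniq.
  rewrite -(perm_uniq (_ : perm_eq (undup m) m)) ?undup_uniq //.
  apply/perm_mult => x; rewrite mult_uniq ?undup_uniq // mem_undup -mult_gt0.
  by case: (ltnP 1 (mult x m)) => [x2|]; [case: no; exists x | lia].
(* The weight of [y] exceeds what the other letters of any [v] can contribute. *)
have [K sizeK] : exists K, forall v, v \in V -> size v < K.
  exists (\sum_(v <- V) size v).+1 => v vV.
  by rewrite ltnS (big_rem v) //= leq_addr.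
have [v vV] := mV (fun x : nat => (x \in m) + K * (x == y)).
have wE u : weight (fun x : nat => (x \in m) + K * (x == y)) u =
    size (filter (mem m) u) + K * mult y u.
  elim: u => [|x u IHu]; first by rewrite weight_nil /mult muln0.
  rewrite weight_cons IHu mult_cons /= (eq_sym y).
  by case: (x \in m); rewrite /= mulnDr; lia.
rewrite !wE => le_mv; exists v => //.
have {}y2v : 2 <= mult y v.
  rewrite leqNgt; apply/negP => v1.
  have : size (filter (mem m) v) < K.
    by apply: leq_ltn_trans (sizeK v vV); rewrite size_filter count_size.
  have : K * 2 <= K * mult y m by rewrite leq_mul2l y2 orbT.
  have : K * mult y v <= K * 1 by rewrite leq_mul2l -ltnS v1 orbT.
  lia.
have y_le : mult y v <= 2.
  by rewrite leqNgt; apply/negP => v3; apply: (light v vV); left; exists y.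
have other x : x != y -> mult x v <= 1.
  move=> xy; rewrite leqNgt; apply/negP => x2; apply: (light v vV).
  by right; exists x, y; split=> //; apply/eqP.
have /dividesP[c vcm] : divides (filter (mem m) v) m.
  move=> x; have [xm|xm] := boolP (x \in m); last first.
    rewrite leqNgt; apply/negP => ?; case/negP: xm.
    suff : x \in filter (mem m) v by rewrite mem_filter => /andP[].
    by rewrite -mult_gt0; lia.
  apply: leq_trans (divides_filter _ _ x) _; have [->|/other/leq_trans] := eqVneq x y; first lia.
  by apply; rewrite mult_gt0.
case: c vcm => [|x c] vcm.
  apply/dividesP; exists (filter (predC (mem m)) v).
  rewrite (perm_trans _ (permEl (perm_filterC (mem m) v))) // perm_cat2r perm_sym.
  by rewrite -[X in perm_eq X]cats0.
have m_filter : filter (mem m) m = m by apply/all_filterP/allP.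
move: le_mv; rewrite m_filter -(perm_size vcm) size_cat /=.
have : K * mult y v <= K * mult y m by rewrite leq_mul2l (leq_trans y_le) ?orbT.
lia.
Qed.

(** The left context [a] is a word; right contexts and sums are covered because
    [below_shift] ignores the order of the letters and is required of every
    word. No word of [s] is heavy, otherwise its instances would be heavy, which
    divisors of exchanged words are not. *)
Lemma D_identity_below_shift n s t g a :
    1 < n -> (forall A, D A -> satisfies A (s, t)) ->
    (forall m, m \in mons t -> uniq m -> size m < n) ->
    (forall u, u \in mons (subst g s) -> below_shift n (a ++ u)) ->
  forall u, u \in mons (subst g t) -> below_shift n (a ++ u).
Proof.
move=> n1 Dst t_small sQ u /mons_subst[z [zt zP ->]].
have [h hg] := choose_mons g.
have h0 x : h x != [::] by apply: mons_word_neq0 (hg x).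
have light v : v \in mons s -> ~ heavy v.
  move=> vs /(heavy_flatten h0) hv.
  apply: (below_shift_light (sQ _ (mons_subst_map vs hg))).
  by apply: heavy_divides hv => x; rewrite mult_cat leq_addl.
have Nst := light_D_identity_N Dst light.
have le_ts f : exists2 v, v \in mons s & weight f (unzip1 z) <= weight f v.
  have [v vs Ev] := eval_weight f s; exists v => //.
  by rewrite -Ev (Nst f) weight_le_eval.
have [z_uniq|z_nuniq] := boolP (uniq (unzip1 z)); last first.
  have [v vs zv] := nonlinear_divides z_nuniq light le_ts.
  have [w ws zw] := mons_subst_divides vs zv zP.
  apply: below_shift_divides (sQ w ws) => x.
  by rewrite !mult_cat leq_add2l.
(* As the letters of the linear word are distinct, the choices in [z] form a
   function of the letter. *)
pose k x := if x \in unzip1 z then nth [::] (unzip2 z) (index x (unzip1 z)) else h x.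
have kg x : k x \in mons (g x).
  rewrite /k; case: ifP => // xz.
  have xlt : index x (unzip1 z) < size z by rewrite -(size_map fst) index_mem.
  rewrite (nth_map (x, [::])) //.
  have := zP _ (mem_nth (x, [::]) xlt).
  by rewrite -(nth_map _ x fst) // nth_index.
have -> : unzip2 z = map k (unzip1 z).
  apply: (@eq_from_nth _ [::]); rewrite ?size_map // => i iz.
  have iz1 : i < size (unzip1 z) by rewrite size_map.
  have [x0 _] : exists x0 : X, True by exists 0.
  by rewrite (nth_map x0) // /k mem_nth // index_uniq.
apply: (@linear_instance_below_shift n a (unzip1 z) k (mons s)) => //.
- exact: t_small.
- by move=> x; apply/eqP/(mons_word_neq0 (kg x)).
- by move=> v vs; apply/sQ/mons_subst_map.
Qed.

(** * Varieties between D and M are not finitely based *)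

Lemma mons_bound t : exists b, forall u x, u \in mons t -> x \in u -> (x : nat) < b.
Proof.
have bound (l : seq nat) : exists b, forall x, x \in l -> x < b.
  exists (\sum_(x <- l) x).+1 => x xl.
  by rewrite ltnS (big_rem x) //= leq_addr.
have [b bP] := bound (flatten (mons t)); exists b => u x ut xu.
by apply: bP; apply/flattenP; exists u.
Qed.

Lemma uniq_bounded_size (u : seq nat) b :
  uniq u -> (forall x, x \in u -> x < b) -> size u <= b.
Proof.
move=> u_uniq ub; rewrite -(size_iota 0 b); apply: uniq_leq_size => // x /ub.
by rewrite mem_iota.
Qed.

(** Exchanging for a letter of maximal weight does not decrease the weight. *)
Lemma cycle_identity n : 1 < n ->
  satisfies N (ineq (term_of_word (iota 0 n)) (term_of_words [seq shift n j | j <- iota 0 n])).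
Proof.
move=> n1; apply: N_ineq => f u.
rewrite mons_term_of_word; last by case: n n1.
rewrite inE => /eqP ->.
rewrite mons_term_of_words; last first.
- by apply/negP => /mapP[j].
- by case: n n1.
have n0 : 0 < n by lia.
pose i0 := Ordinal n0.
case: (@arg_maxnP _ i0 predT (fun j : 'I_n => f j) isT) => j _ jmax.
exists (shift n j); first by rewrite map_f // mem_iota /=.
have := weight_shift f (ltn_ord j).
by have := jmax (Ordinal (cyclic_next_lt (ltn_ord j))) isT => /=; lia.
Qed.

(** Finitely many identities use fewer than [n] letters for some [n]. Two terms are
    identified when, for every word [a], the multiples of their words by [a] are
    simultaneously divisors of exchanged words; by [D_identity_below_shift] the
    quotient satisfies the given identities, but the product of all [n] letters
    and the sum of the exchanged words are told apart by the empty [a]. *)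
Theorem not_finitely_based_above_D (K : class) :
  subvariety D K -> subvariety K M -> ~ finitely_based K.
Proof.
move=> DK KM [E EK].
have [b bP] : exists b, forall e, List.In e E ->
    forall u x, u \in mons e.1 ++ mons e.2 -> x \in u -> (x : nat) < b.
  elim: E {EK} => [|e E [b bP]]; first by exists 0.
  have [b1 b1P] := mons_bound (Add e.1 e.2).
  exists (maxn b1 b) => e' /= [<-|e'E] u x ue xu; rewrite leq_max.
    by rewrite (b1P u x).
  by rewrite (bP e' e'E u x) ?orbT.
pose n := b.+2.
pose Q a t := forall u, u \in mons t -> below_shift n (a ++ u).
have [|||||B [q [q_hom q_surj qE]]] :=
  @quotient_exists term_algebra (fun s t => forall a, Q a s <-> Q a t).
- by [].
- by move=> s t st a; rewrite st.
- by move=> r s t rs st a; rewrite rs.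
- have QD a s t : Q a (Add s t) <-> Q a s /\ Q a t.
    split=> [st|[sQ tQ] u]; last by rewrite mem_cat => /orP[/sQ|/tQ].
    by split=> u us; apply: st; rewrite mem_cat us ?orbT.
  by move=> s s' t t' ss' tt' a; rewrite !QD ss' tt'.
- have QM a s t : Q a (Mul s t) <-> forall u, u \in mons s -> Q (a ++ u) t.
    split=> [st u us v vt|st w /allpairsP[[u v] /= [us vt ->]]].
      by rewrite -catA; apply: st; apply/allpairsP; exists (u, v).
    by rewrite catA; apply: st.
  have QMC a s t : Q a (Mul s t) <-> forall v, v \in mons t -> Q (a ++ v) s.
    rewrite QM; split=> st u us v vt.
      apply: below_shift_divides (st v vt u us) => x.
      by rewrite !mult_cat addnAC.
    apply: below_shift_divides (st v vt u us) => x.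
    by rewrite !mult_cat addnAC.
  move=> s s' t t' ss' tt' a; apply: (iff_trans (QMC _ _ _)).
  apply: (@iff_trans _ (Q a (Mul s' t))); last first.
    by rewrite !QM; split=> st u us; apply/tt'/st.
  by rewrite QMC; split=> st u us; apply/ss'/st.
have KB : K B.
  apply/EK => e eE v.
  have /choice[g gv] x : exists t, q t = v x by apply: q_surj.
  rewrite -!(eq_eval _ gv) -!(@eval_hom term_algebra _ q) //; apply/qE => a.
  have small t m : (forall u x, u \in mons t -> x \in u -> (x : nat) < b) ->
      m \in mons t -> uniq m -> size m < n.
    move=> tb mt m_uniq; have := uniq_bounded_size m_uniq (fun x => tb m x mt).
    by move/leq_ltn_trans; apply; rewrite /n; lia.
  have De A : D A -> satisfies A e by move=> /DK/EK; apply.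
  split; apply: D_identity_below_shift => //.
  - by move=> m; apply: small => u x ut; apply: (bP e eE); rewrite mem_cat ut orbT.
  - by move=> A DA w /=; rewrite De.
  - by move=> m; apply: small => u x ut; apply: (bP e eE); rewrite mem_cat ut.
have := M_satisfies (KM _ KB) (@cycle_identity n isT) (q \o Var).
rewrite -!(@eval_hom term_algebra _ q) //.
have subst_Var t : eval (A := term_algebra) Var t = t by elim: t => //= s -> t ->.
rewrite !subst_Var => /qE/(_ [::])[_ shifts_prod].
have mons_shifts : mons (term_of_words [seq shift n j | j <- iota 0 n]) =
    [seq shift n j | j <- iota 0 n].
  by rewrite mons_term_of_words //; apply/negP => /mapP[j].
have shiftsQ : Q [::] (term_of_words [seq shift n j | j <- iota 0 n]).
  move=> u; rewrite mons_shifts => /mapP[j].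
  by rewrite mem_iota => /andP[_ jn] ->; exists j.
have [|j jn /(_ (cyclic_next n j))] := shifts_prod shiftsQ (iota 0 n).
  rewrite -[mons _]/(mons (term_of_word (iota 0 n)) ++ mons _) mem_cat.
  by rewrite mons_term_of_word // mem_seq1 eqxx.
have := mult_shift (cyclic_next n j) jn; have := cyclic_next_lt jn; have := @cyclic_next_neq n j isT.
by rewrite cat0s mult_iota; lia.
Qed.

(** * Words in models of the laws of commutative ai-semirings with x <= xy *)

(** Associativity and commutativity of both operations, idempotence of addition,
    distributivity, and [x <= x y]. *)
Definition axioms : seq identity :=
  let x := Var 0 in let y := Var 1 in let z := Var 2 in
  [:: (Add x (Add y z), Add (Add x y) z); (Add x y, Add y x); (Add x x, x);
      (Mul x (Mul y z), Mul (Mul x y) z); (Mul x y, Mul y x);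
      (Mul (Add x y) z, Add (Mul x z) (Mul y z));
      ineq x (Mul x y)].

Definition models (A : algebra) (E : seq identity) : Prop :=
  forall e, List.In e E -> satisfies A e.

Lemma models_cons A e E : models A (e :: E) <-> satisfies A e /\ models A E.
Proof.
split=> [AE|[Ae AE] e' /= [<-//|/AE//]].
by split=> [|e' e'E]; apply: AE => /=; auto.
Qed.

Lemma N_axioms : models N axioms.
Proof. by rewrite !models_cons; do 7?[split; first by move=> v /=; lia]. Qed.

Lemma valuation3 (A : Type) (a b c : A) :
  exists v : X -> A, [/\ v 0 = a, v 1 = b & v 2 = c].
Proof.
by exists (fun i : nat => if i is i'.+1 then (if i' is 0 then b else c) else a).
Qed.

Section Order.

Context (A : algebra) (axA : models A axioms).

Lemma axioms_laws :
  [/\ [/\ associative (@add A), commutative (@add A) & idempotent_op (@add A)],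
      associative (@mul A) /\ commutative (@mul A),
      left_distributive (@mul A) add & forall a b : A, add a (mul a b) = mul a b].
Proof.
move: axA; rewrite !models_cons /satisfies /= => -[H1 [H2 [H3 [H4 [H5 [H6 [H7 _]]]]]]].
split; [split | split | |].
- by move=> a b c; have [v [<- <- <-]] := valuation3 a b c; apply: H1.
- by move=> a b; have [v [<- <- _]] := valuation3 a b a; apply: H2.
- by move=> a; have [v [<- _ _]] := valuation3 a a a; apply: H3.
- by move=> a b c; have [v [<- <- <-]] := valuation3 a b c; apply: H4.
- by move=> a b; have [v [<- <- _]] := valuation3 a b a; apply: H5.
- by move=> a b c; have [v [<- <- <-]] := valuation3 a b c; apply: H6.
- by move=> a b; have [v [<- <- _]] := valuation3 a b a; apply: H7.
Qed.

Definition le (a b : A) : Prop := add a b = b.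

Let addA : associative (@add A). Proof. by case: axioms_laws => -[]. Qed.
Let addC : commutative (@add A). Proof. by case: axioms_laws => -[]. Qed.
Let addI : idempotent_op (@add A). Proof. by case: axioms_laws => -[]. Qed.
Let mulA : associative (@mul A). Proof. by case: axioms_laws => _ []. Qed.
Let mulC : commutative (@mul A). Proof. by case: axioms_laws => _ []. Qed.
Let mulDl : left_distributive (@mul A) add. Proof. by case: axioms_laws. Qed.
Let le_mul a b : le a (mul a b). Proof. by case: axioms_laws => _ _ _; apply. Qed.

Lemma le_refl a : le a a. Proof. exact: addI. Qed.

Lemma le_trans a b c : le a b -> le b c -> le a c.
Proof. by rewrite /le => ab <-; rewrite addA ab. Qed.

Lemma le_antisym a b : le a b -> le b a -> a = b.
Proof. by rewrite /le => ab <-; rewrite addC ab. Qed.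

Lemma le_add a b c : le (add a b) c <-> le a c /\ le b c.
Proof.
rewrite /le; split=> [<-|[ac bc]]; last by rewrite -addA bc.
by rewrite !addA addI [add b a]addC -!addA [add b (add b _)]addA addI.
Qed.

Let prodo (v : X -> A) (u : seq X) : option A := \big[oAC mulA mulC/None]_(x <- u) Some (v x).

Lemma eval_word (v : X -> A) u : u != [::] -> Some (eval v (term_of_word u)) = prodo v u.
Proof.
case: u => // x u _; rewrite /prodo big_cons.
rewrite -[Some (v x)]/(Some (eval v (Var x))) /term_of_word.
elim: u (Var x) => [|y u IHu] t; first by rewrite big_nil.
by rewrite big_cons /= IHu [RHS]Monoid.mulmA.
Qed.

Lemma eval_word_cat (v : X -> A) u w : u != [::] -> w != [::] ->
  eval v (term_of_word (u ++ w)) = mul (eval v (term_of_word u)) (eval v (term_of_word w)).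
Proof.
move=> u0 w0; apply: (@Some_inj _ _ _); rewrite eval_word /prodo; last by case: (u) u0.
by rewrite big_cat /= -!/(prodo _ _) -!eval_word.
Qed.

Lemma eval_word_perm (v : X -> A) u w : u != [::] -> perm_eq u w ->
  eval v (term_of_word u) = eval v (term_of_word w).
Proof.
move=> u0 uw; have w0 : w != [::].
  by apply: contraNneq u0 => w0; move: uw; rewrite w0 => /perm_nilP->.
by apply: (@Some_inj _ _ _); rewrite !eval_word // /prodo (perm_big w).
Qed.

Lemma eval_word_divides (v : X -> A) u w : u != [::] -> divides u w ->
  le (eval v (term_of_word u)) (eval v (term_of_word w)).
Proof.
move=> u0 /dividesP[c ucw].
have uc0 : u ++ c != [::] by case: (u) u0.
rewrite -(eval_word_perm v uc0 ucw).
have [->|c0] := eqVneq c [::]; first by rewrite cats0; apply: le_refl.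
by rewrite eval_word_cat.
Qed.

Lemma le_mul2 a b c d : le a b -> le c d -> le (mul a c) (mul b d).
Proof.
have le_mulr x y z : le x y -> le (mul x z) (mul y z) by rewrite /le -mulDl => ->.
move=> ab cd; apply: le_trans (le_mulr _ _ c ab) _.
by rewrite ![mul b _]mulC; apply: le_mulr.
Qed.

Lemma word_le_eval (v : X -> A) t u : u \in mons t -> le (eval v (term_of_word u)) (eval v t).
Proof.
elim: t u => [x|s IHs t IHt|s IHs t IHt] u /=.
- by rewrite inE => /eqP->; apply: le_refl.
- have /le_add[ls lt] := le_refl (add (eval v s) (eval v t)).
  by rewrite mem_cat => /orP[/IHs us|/IHt ut]; [apply: le_trans ls | apply: le_trans lt].
- case/allpairsP=> -[u1 u2] /= [u1s u2t ->].
  rewrite eval_word_cat ?(mons_word_neq0 u1s) ?(mons_word_neq0 u2t) //.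
  by apply: le_mul2; auto.
Qed.

(** The additive map [f] carries the multiplicative context through the induction
    on products, because the order is not residuated. *)
Lemma eval_le_additive (v : X -> A) t (f : A -> A) b :
    {morph f : a b / add a b} ->
    (forall u, u \in mons t -> le (f (eval v (term_of_word u))) b) ->
  le (f (eval v t)) b.
Proof.
elim: t f => [x|s IHs t IHt|s IHs t IHt] f fD tb /=.
- by apply: (tb [:: x]); rewrite inE.
- rewrite fD; apply/le_add; split; [apply: IHs => // u us | apply: IHt => // u ut];
    by apply: tb; rewrite mem_cat ?us ?ut ?orbT.
- apply: (IHs (fun a => f (mul a (eval v t)))) => [a a'|u us]; first by rewrite mulDl fD.
  apply: (IHt (fun a => f (mul (eval v (term_of_word u)) a))) => [a a'|w wt].
    by rewrite !(mulC (eval v _)) mulDl fD.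
  rewrite -eval_word_cat ?(mons_word_neq0 us) ?(mons_word_neq0 wt) //.
  by apply: tb; apply/allpairsP; exists (u, w).
Qed.

Lemma eval_le (v : X -> A) t b :
  (forall u, u \in mons t -> le (eval v (term_of_word u)) b) -> le (eval v t) b.
Proof. exact: (@eval_le_additive v t id). Qed.

End Order.

Lemma eval_word_map (A : algebra) (v : X -> A) (f : X -> X) u : u != [::] ->
  eval v (term_of_word (map f u)) = eval (v \o f) (term_of_word u).
Proof.
case: u => // x u _; rewrite /term_of_word /=.
have: eval v (Var (f x)) = eval (v \o f) (Var x) by [].
elim: u (Var (f x)) (Var x) => //= y u IHu s t st.
by apply: IHu; rewrite /= st.
Qed.

Lemma eq_in_eval_word (A : algebra) (v w : X -> A) u : u != [::] ->
  {in u, v =1 w} -> eval v (term_of_word u) = eval w (term_of_word u).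
Proof.
case: u => // x u _ vw; rewrite /term_of_word.
have: eval v (Var x) = eval w (Var x) by apply: vw; rewrite inE eqxx.
have {vw}: {in u, v =1 w} by move=> y yu; apply: vw; rewrite inE yu orbT.
elim: u (Var x) => //= y u IHu t vw vwt; apply: IHu => /= [z zu|].
  by apply: vw; rewrite inE zu orbT.
by rewrite vwt vw ?inE ?eqxx.
Qed.

(** * The finite set of short inequalities of a class *)

Lemma In_cat (T : Type) (a : T) s t : List.In a (s ++ t) <-> List.In a s \/ List.In a t.
Proof. by elim: s => [|b s IHs] /=; tauto. Qed.

Lemma In_map (T : eqType) (U : Type) (f : T -> U) s b :
  List.In b (map f s) <-> exists2 a, a \in s & f a = b.
Proof.
elim: s => [|a s IHs] /=; first by split=> // -[].
split=> [[ab|/IHs[c cs cb]]|[c]]; first by exists a; rewrite ?inE ?eqxx.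
  by exists c; rewrite // inE cs orbT.
by rewrite inE => /orP[/eqP->|cs] cb; [left | right; apply/IHs; exists c].
Qed.

Section Basis.

Context (K : class) (n : nat).

Local Notation letter := 'I_n.+1.
Local Notation short := {bseq n.+1 of letter}.

Definition spell (w : seq letter) : seq X := map val w.

(** All inequalities between a word and a sum of words, with at most [n + 1]
    letters and words of length at most [n + 1]; they are indexed by a finite
    type. Indices with empty words or sums give meaningless identities, which
    are harmless because [basis] keeps only the identities valid in [K]. *)
Definition short_ineq (p : short * {set short}) : identity :=
  ineq (term_of_word (spell p.1)) (term_of_words [seq spell (w : short) | w <- enum p.2]).

Definition basis : seq identity :=
  axioms ++ [seq short_ineq p |
    p <- enum [pred p | `[< forall A, K A -> satisfies A (short_ineq p) >]]].

Lemma models_basis A : models A basis <->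
  models A axioms /\
  forall p, (forall B, K B -> satisfies B (short_ineq p)) ->
    satisfies A (short_ineq p).
Proof.
split=> [Ab|[Aax Ap] e /In_cat[/Aax //|/In_map[p + <-]]].
  split=> [e eax|p Kp]; apply: Ab; apply/In_cat; first by left.
  by right; apply/In_map; exists p; rewrite // mem_enum; apply/asboolP.
by rewrite mem_enum => /asboolP; apply: Ap.
Qed.

(** Renaming the letters of [c] to [0, ..., n] makes the inequality one of the
    [short_ineq]; validity in [K] is invariant under renaming. *)
Lemma basis_short A (c m : seq X) (P : seq (seq X)) :
    subvariety K M -> models A basis ->
    m != [::] -> P != [::] -> [::] \notin P -> size c <= n.+1 ->
    (forall u, u \in m :: P -> size u <= n.+1 /\ {subset u <= c}) ->
    (forall B, K B -> satisfies B (ineq (term_of_word m) (term_of_words P))) ->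
  satisfies A (ineq (term_of_word m) (term_of_words P)).
Proof.
move=> KM /models_basis[Aax Ab] m0 P0 nilP c_size mP_short KmP.
pose enc (x : X) : letter := inord (index x c).
pose dec (i : nat) : X := nth 0 c i.
have encK x : x \in c -> dec (enc x) = x.
  by move=> xc; rewrite /dec inordK ?nth_index // (leq_trans _ c_size) // index_mem.
pose code (u : seq X) : short := insub_bseq n.+1 (map enc u).
have codeE u : u \in m :: P -> spell (code u) = map (fun x => val (enc x)) u.
  move=> /mP_short[u_size _].
  by rewrite /spell /code insubdK ?unfold_in ?size_map // -map_comp.
pose S := [set w in map code P].
have spell0 u : u \in m :: P -> spell (code u) != [::].
  move=> umP; rewrite codeE //; have : u != [::].
    by move: umP; rewrite inE => /orP[/eqP->//|]; apply: contraTneq => ->.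
  by case: u {umP}.
have S_words : mons (term_of_words [seq spell (w : short) | w <- enum S]) =
    [seq spell (w : short) | w <- enum S].
  apply: mons_term_of_words.
    case: P P0 @S {nilP mP_short KmP codeE spell0} => // u P _ S.
    have : code u \in enum S by rewrite mem_enum !inE eqxx.
    by case: (enum S).
  apply/negP => /mapP[w]; rewrite mem_enum inE => /mapP[u uP ->].
  by move/esym/eqP; apply/negP/spell0; rewrite inE uP orbT.
have mem_S u : u \in P -> spell (code u) \in [seq spell (w : short) | w <- enum S].
  by move=> uP; apply/map_f; rewrite mem_enum inE map_f.
have short_valid := Ab (code m, S).
have {}short_valid : satisfies A (short_ineq (code m, S)).
  apply: short_valid => B KB v /=.
  have Bax : models B axioms by move=> e /N_axioms; apply: M_satisfies (KM _ KB).
  rewrite codeE ?inE ?eqxx // eval_word_map //.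
  apply: (le_trans Bax (KmP B KB _)); apply: (eval_le Bax) => u.
  rewrite mons_term_of_words // => uP; have umP : u \in m :: P by rewrite inE uP orbT.
  have := @word_le_eval B Bax v
    (term_of_words [seq spell (w : short) | w <- enum S]) (spell (code u)).
  rewrite S_words mem_S // codeE // eval_word_map; first by apply.
  by apply: contraNneq nilP => <-.
move=> v; have := short_valid (v \o dec) => /=.
rewrite codeE ?inE ?eqxx // eval_word_map //.
rewrite (@eq_in_eval_word _ _ v m m0); last first.
  by move=> x xm /=; rewrite encK //; have [] := mP_short m; rewrite ?inE ?eqxx // => _ /(_ x xm).
move=> valid; apply: (le_trans Aax valid); apply: (eval_le Aax) => w.
rewrite S_words => /mapP[w' w'S ->]; move: w'S; rewrite mem_enum inE => /mapP[u uP ->].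
have umP : u \in m :: P by rewrite inE uP orbT.
have u0 : u != [::] by apply: contraNneq nilP => <-.
rewrite codeE // eval_word_map // (@eq_in_eval_word _ _ v u u0).
  by apply: (word_le_eval Aax); rewrite mons_term_of_words.
by move=> x xu /=; rewrite encK //; have [_ ->] := mP_short u umP.
Qed.

End Basis.

(** * Monomials and instances of words that are not heavy *)

Definition word_of (w : monomial) : seq X := enum_mset (val w).

Lemma term_of_monomialE w : term_of_monomial w = term_of_word (word_of w).
Proof. by []. Qed.

Lemma occE x w : occ x w = mult x (word_of w).
Proof. by rewrite /occ -count_mem_mset. Qed.

Lemma word_of_neq0 w : word_of w != [::].
Proof.
apply: contraNneq (valP w) => w0; apply/eqP/msetP => x.
by rewrite -count_mem_mset -/(word_of w) w0 mset0E.
Qed.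

Lemma mem_word_of x w : (x \in word_of w) = (x \in content w).
Proof. by rewrite -mult_gt0 -occE /content mem_finsupp lt0n. Qed.

Lemma not_heavyE u : ~ heavy u <->
  (forall x, mult x u <= 2) /\ (forall x y, mult x u = 2 -> mult y u = 2 -> x = y).
Proof.
split=> [light|[u2 u_one]].
  have u2 x : mult x u <= 2.
    by rewrite leqNgt; apply/negP => x3; apply: light; left; exists x.
  split=> // x y x2 y2; apply: contrapT => xy; apply: light; right.
  by exists x, y; rewrite x2 y2.
case=> [[x]|[x [y [xy x2 y2]]]]; first by rewrite ltnNge u2.
by apply: xy; apply: u_one; apply/eqP; rewrite eqn_leq u2.
Qed.

Lemma nuniq_perm (u : seq X) : ~~ uniq u -> exists x s, perm_eq u [:: x, x & s].
Proof.
elim: u => //= x u IHu; rewrite negb_and negbK => /orP[xu|/IHu[y [s us]]].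
  by exists x, (rem x u); rewrite perm_cons perm_to_rem.
exists y, (x :: s); rewrite -(perm_cons x) in us; apply: perm_trans us _.
by apply/permP => a /=; lia.
Qed.

Lemma uniq_map_take (u w : seq X) : uniq u -> size u <= size w ->
  exists f, map f u = take (size u) w.
Proof.
move=> u_uniq uw; exists (fun x => nth x w (index x u)).
have [x0 _] : exists x0 : X, True by exists 0.
apply: (@eq_from_nth _ x0); first by rewrite size_map size_takel.
move=> i; rewrite size_map => iu.
rewrite (nth_map x0) // index_uniq // nth_take //; apply: set_nth_default.
exact: leq_trans uw.
Qed.

Lemma divides_take n w : divides (take n w) w.
Proof. by apply/dividesP; exists (drop n w); rewrite cat_take_drop. Qed.

(** Rename the letters of [u] to the first letters of [w]. *)
Lemma uniq_divides_instance (u w : seq X) : uniq u -> size u <= size w ->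
  exists f, divides (map f u) w.
Proof.
by move=> u_uniq /(uniq_map_take u_uniq)[f Ef]; exists f; rewrite Ef; apply: divides_take.
Qed.

(** If [u] has a double letter, send it to a repeated letter of [w] and the other
    letters, which are simple, to distinct remaining occurrences in [w]. *)
Lemma light_divides_instance (u w : seq X) : ~ heavy u -> ~~ uniq w -> size u <= size w ->
  exists f, divides (map f u) w.
Proof.
move=> light /nuniq_perm[x [s ws]] uw.
have [u_uniq|/nuniq_perm[y [t ut]]] := boolP (uniq u); first exact: uniq_divides_instance.
have mult_ut a : mult a u = (a == y) + ((a == y) + mult a t).
  by move/perm_mult: ut => ->; rewrite !mult_cons.
have yt : y \notin t.
  apply/negP; rewrite -mult_gt0 => ty; apply: light; left; exists y.
  by rewrite mult_ut eqxx; lia.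
have t_uniq : uniq t.
  apply/negPn/negP => /nuniq_perm[a [t' tt']]; apply: light; right.
  have ta : 2 <= mult a t by move/perm_mult: tt' => ->; rewrite !mult_cons eqxx; lia.
  exists a, y; rewrite !mult_ut eqxx; split=> //; last lia.
  by move=> ay; case/negP: yt; rewrite -mult_gt0 -ay; lia.
have [|f ft] := @uniq_map_take t s t_uniq.
  by move: uw; rewrite (perm_size ut) (perm_size ws).
exists (fun a => if a == y then x else f a) => a.
have /perm_mult -> := perm_map (fun a => if a == y then x else f a) ut.
move/perm_mult: ws => ->; rewrite [map _ _]/= eqxx !mult_cons !leq_add2l.
rewrite (_ : map _ t = map f t); first by rewrite ft; apply: divides_take.
by apply/eq_in_map => b bt; case: eqP => // b_y; rewrite -b_y bt in yt.
Qed.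

Lemma perm_of_uniq_subset (m u : seq X) : {subset u <= m} -> size m <= size u ->
  uniq u -> perm_eq m u.
Proof.
move=> um mu u_uniq; rewrite perm_sym uniq_perm //.
  by apply: leq_size_uniq mu.
by have [] := uniq_min_size u_uniq um mu.
Qed.

(** * The varieties defined by Omega *)

Section Main.

Context (Omega : monomial -> Prop) (z : monomial -> X).
Context (z_fresh : forall w, Omega w -> z w \notin content w).

Lemma V_sub_M : subvariety (V_ Omega z) M.
Proof. by move=> A []. Qed.

Lemma V_top A w : V_ Omega z A -> Omega w ->
  satisfies A (ineq (Var (z w)) (term_of_word (word_of w))).
Proof.
move=> [MA AO] Ow v.
have [[_ addC _] _ _ _] := axioms_laws (fun e eax => M_satisfies MA (N_axioms eax)).
rewrite [LHS]/= addC; exact: (AO _ (ex_intro2 _ _ w Ow (erefl _)) v).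
Qed.

(** A heavy [w] is a multiple of [x^3] or [x^2 y^2], which are greatest in [D], and
    multiples are larger. *)
Lemma D_sub_V : (forall w, Omega w -> heavy (word_of w)) -> subvariety D (V_ Omega z).
Proof.
move=> O_heavy A [MA AD]; split=> // _ [w /O_heavy w_heavy ->] v.
have Aax : models A axioms by move=> e /N_axioms; apply: M_satisfies MA.
have [[_ addC _] _ _ _] := axioms_laws Aax.
rewrite [LHS]/= addC term_of_monomialE -/(le _ _).
case: w_heavy => [[x x3]|[x [y [xy x2 y2]]]].
  apply: (@le_trans _ Aax _ (eval v (term_of_word [:: x; x; x]))).
    have [f [f0 _ f2]] := valuation3 (v x) (v x) (v (z w)).
    by have := AD _ (or_introl (erefl _)) f; rewrite /= f0 f2 addC.
  apply: eval_word_divides => // a; rewrite !mult_cons mult_nil.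
  by have [->|_] := eqVneq a x; lia.
apply: (@le_trans _ Aax _ (eval v (term_of_word [:: x; x; y; y]))).
  have [f [f0 f1 f2]] := valuation3 (v x) (v y) (v (z w)).
  have [_ [mulA _] _ _] := axioms_laws Aax.
  by have := AD _ (or_intror (erefl _)) f; rewrite /= f0 f1 f2 addC !mulA.
apply: eval_word_divides => // a; rewrite !mult_cons mult_nil.
have [->|_] := eqVneq a x; first by have /eqP/negPf -> := xy; lia.
by have [->|_] := eqVneq a y; lia.
Qed.

(** Otherwise [w + z = w] would hold in [N]; the valuation that is 1 at [z] and 0
    elsewhere refutes it, as [z] does not occur in [w]. *)
Lemma D_not_sub_V w : Omega w -> ~ heavy (word_of w) -> ~ subvariety D (V_ Omega z).
Proof.
move=> Ow light DV.
have w0 := word_of_neq0 w.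
have De A : D A -> satisfies A
    (term_of_word (word_of w), Add (term_of_word (word_of w)) (Var (z w))).
  move=> /DV[_ AO] v; apply/esym.
  exact: (AO _ (ex_intro2 _ _ w Ow (erefl _)) v).
have light_w u : u \in mons (term_of_word (word_of w)) -> ~ heavy u.
  by rewrite mons_term_of_word // inE => /eqP ->.
have := light_D_identity_N De light_w (fun x : nat => x == z w).
have [u] := eval_weight (fun x : nat => x == z w) (term_of_word (word_of w)).
rewrite mons_term_of_word // inE => /eqP -> /= ->; rewrite weight_count eqxx.
move: (z_fresh Ow); rewrite -mem_word_of -mult_gt0; lia.
Qed.

(** The bound [n] also covers some linear word of [Omega], if there is one: it makes
    all longer linear words of [Omega] greatest, while the longer words with a
    repeated letter are handled by [w1]. *)
Theorem finitely_based_V w1 : Omega w1 -> ~ heavy (word_of w1) -> finitely_based (V_ Omega z).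
Proof.
move=> Ow1 light1.
have [n [w1n uniq_n]] : exists n, size (word_of w1) <= n /\
    forall w, Omega w -> uniq (word_of w) ->
      exists2 w0, Omega w0 & uniq (word_of w0) /\ size (word_of w0) <= n.
  have [[w0 [Ow0 w0_uniq]]|no] := pselect (exists w0, Omega w0 /\ uniq (word_of w0)).
    exists (maxn (size (word_of w1)) (size (word_of w0))).
    by rewrite leq_maxl; split=> // w _ _; exists w0; rewrite ?leq_maxr.
  by exists (size (word_of w1)); split=> // w Ow w_uniq; case: no; exists w.
exists (basis (V_ Omega z) n) => A; split=> [VA|Ab].
  apply/models_basis; split=> [e /N_axioms|p]; last by apply.
  by apply: M_satisfies (V_sub_M VA).
have [Aax _] := (models_basis (V_ Omega z) n A).1 Ab.
pose top (u : seq X) := forall v b, le b (eval (A := A) v (term_of_word u)).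
have top_instance f u w : top u -> u != [::] -> divides (map f u) w -> top w.
  move=> u_top u0 fuw v b; apply: (le_trans Aax (u_top (v \o f) b)).
  by rewrite -eval_word_map //; apply: (eval_word_divides Aax) => //; case: (u) u0.
have top_short w : Omega w -> size (word_of w) <= n -> top (word_of w).
  move=> Ow w_size v b; have w0 := word_of_neq0 w.
  have zw : z w \notin word_of w by rewrite mem_word_of z_fresh.
  have valid : satisfies A (ineq (term_of_word [:: z w]) (term_of_words [:: word_of w])).
    apply: (@basis_short _ n A (z w :: word_of w) _ _ V_sub_M Ab) => //.
  - by rewrite inE eq_sym.
  - move=> u; rewrite !inE => /orP[/eqP->|/eqP->]; split=> //; try exact: leqW.
      by move=> x; rewrite inE => /eqP->; rewrite inE eqxx.
    by move=> x xw; rewrite inE xw orbT.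
  - by move=> B VB; apply: V_top VB Ow.
  move: (valid (fun x => if x == z w then b else v x)); rewrite /= eqxx.
  congr (le b _); apply: eq_in_eval_word => // x xw.
  by case: eqP => // xz; rewrite -xz xw in zw.
have top_long u : ~~ uniq u -> n < size u -> top u.
  move=> u_nuniq n_u; have [|f fu] := light_divides_instance light1 u_nuniq.
    by apply: leq_trans w1n (ltnW n_u).
  exact: top_instance (top_short w1 Ow1 w1n) (word_of_neq0 w1) fu.
have top_Omega w : Omega w -> top (word_of w).
  move=> Ow; have [/top_short|n_w] := leqP (size (word_of w)) n; first exact.
  have [w_uniq|/top_long] := boolP (uniq (word_of w)); last exact.
  have [w0 Ow0 [w0_uniq w0n]] := uniq_n w Ow w_uniq.
  have [f fw] := uniq_divides_instance w0_uniq (leq_trans w0n (ltnW n_w)).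
  exact: top_instance (top_short w0 Ow0 w0n) (word_of_neq0 w0) fw.
have N_le m t : m != [::] -> satisfies N (ineq (term_of_word m) t) ->
    forall v, le (eval (A := A) v (term_of_word m)) (eval v t).
  move=> m0 Nmt v.
  have [[u [ut u_nuniq n_u]]|no_long] :=
      pselect (exists u, [/\ u \in mons t, ~~ uniq u & n < size u]).
    exact: (le_trans Aax (top_long u u_nuniq n_u v _) (word_le_eval Aax v ut)).
  pose r u := filter (mem m) u.
  have le_mt f : exists2 u, u \in mons t & weight f m <= weight f (r u).
    pose f' x := if x \in m then f x else 0.
    have [u ut Eu] := eval_weight f' t; exists u => //.
    have : weight f' m <= weight f' u.
      rewrite -Eu; apply: (@leq_trans (eval (A := N) f' (term_of_word m))).
        by apply: weight_le_eval; rewrite mons_term_of_word // inE.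
      by apply/maxn_idPr/Nmt.
    rewrite [weight f' u]/weight -big_mkcond -big_filter.
    by congr (_ <= _); apply: eq_big_seq => x xm; rewrite /f' xm.
  (* The weight 1 on the letters of [m] compares lengths: some [r u] is at least
     as long as [m]. *)
  have [u ut] := le_mt (fun=> 1); rewrite /weight !sum1_size => m_u.
  have r_sub u' : {subset r u' <= m} by move=> x; rewrite mem_filter => /andP[].
  (* If [u] is linear, then so is [m], and [m] divides [u]. Otherwise [u] is short,
     hence so are [m] and all [r u']. *)
  have [u_uniq|u_nuniq] := boolP (uniq u).
    apply: (le_trans Aax _ (word_le_eval Aax v ut)); apply: (eval_word_divides Aax) => //.
    have /perm_mult mE := perm_of_uniq_subset (r_sub u) m_u (filter_uniq _ u_uniq).
    by move=> x; rewrite mE; apply: divides_filter.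
  have u_n : size u <= n.
    by rewrite leqNgt; apply/negP => n_u; apply: no_long; exists u.
  have m_n : size m <= n.
    by apply: leq_trans u_n; apply: leq_trans m_u _; rewrite size_filter count_size.
  have r_n u' : u' \in mons t -> size (r u') <= n.
    move=> u't; have [u'_uniq|u'_nuniq] := boolP (uniq u').
      by apply: leq_trans m_n; apply: uniq_leq_size (r_sub u'); rewrite filter_uniq.
    apply: leq_trans (_ : size u' <= n); first by rewrite size_filter count_size.
    by rewrite leqNgt; apply/negP => n_u'; apply: no_long; exists u'.
  pose P := [seq w <- map r (mons t) | w != [::]].
  have P_mem w : w \in P -> exists2 u', u' \in mons t & w = r u'.
    by rewrite mem_filter => /andP[_ /mapP].
  have nilP : [::] \notin P by rewrite mem_filter.
  have ruP : r u \in P.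
    rewrite mem_filter map_f // andbT -size_eq0 -lt0n (leq_trans _ m_u) //.
    by rewrite lt0n size_eq0.
  have P0 : P != [::] by case: (P) ruP.
  have Nvalid : satisfies N (ineq (term_of_word m) (term_of_words P)).
    apply: N_ineq => f w; rewrite !mons_term_of_word // mons_term_of_words //.
    rewrite inE => /eqP ->; have [u' u't mu'] := le_mt f.
    (* Erasing may leave an empty word, which is no term; it only bounds [m] when
       [m] has weight 0, and then any other word does. *)
    have [ru'0|ru'0] := eqVneq (r u') [::].
      by exists (r u) => //; move: mu'; rewrite ru'0 weight_nil leqn0 => /eqP ->.
    by exists (r u') => //; rewrite mem_filter ru'0 map_f.
  have valid : satisfies A (ineq (term_of_word m) (term_of_words P)).
    apply: (@basis_short _ n A (undup m) _ _ V_sub_M Ab) => //.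
    - by rewrite (leq_trans (size_undup m)) // leqW.
    - move=> w; rewrite inE => /orP[/eqP->|/P_mem[u' u't ->]].
        by split; [apply: leqW | move=> x; rewrite mem_undup].
      by split; [apply/leqW/r_n | move=> x /r_sub; rewrite mem_undup].
    - by move=> B VB; apply: M_satisfies (V_sub_M VB) Nvalid.
  apply: (le_trans Aax (valid v)); apply: (eval_le Aax) => w.
  rewrite mons_term_of_words // => wP; have [u' u't Ew] := P_mem w wP.
  apply: (le_trans Aax _ (word_le_eval Aax v u't)); apply: (eval_word_divides Aax).
    by apply: contraNneq nilP => <-.
  by rewrite Ew; apply: divides_filter.
split; last first.
  move=> _ [w Ow ->] v; have [[_ addC _] _ _ _] := axioms_laws Aax.
  by rewrite [LHS]/= addC; apply: top_Omega.
have Nst_le s t : satisfies N (s, t) -> forall v, le (eval (A := A) v s) (eval v t).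
  move=> Nst v; apply: (eval_le Aax) => m ms; apply: N_le (mons_word_neq0 ms) _ v.
  move=> f /=; apply/maxn_idPr; rewrite -(Nst f) /=.
  have [u] := eval_weight f (term_of_word m).
  by rewrite mons_term_of_word ?(mons_word_neq0 ms) // inE => /eqP -> ->; apply: weight_le_eval.
apply: birkhoff => -[s t] Nst v; apply: (le_antisym Aax); apply: Nst_le => //.
Qed.

End Main.

Theorem theorem9p2 (Omega : monomial -> Prop) (z : monomial -> X)
    (z_fresh : forall w, Omega w -> z w \notin content w) :
  (finitely_based (V_ Omega z) <->
    exists2 w, Omega w &
      (forall x, occ x w <= 2) /\
      (forall x y, occ x w = 2 -> occ y w = 2 -> x = y)) /\
  ((exists2 w, Omega w &
      (forall x, occ x w <= 2) /\
      (forall x y, occ x w = 2 -> occ y w = 2 -> x = y)) <->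
    ~ subvariety D (V_ Omega z)).
Proof.
have occ_light w : ((forall x, occ x w <= 2) /\
    (forall x y, occ x w = 2 -> occ y w = 2 -> x = y)) <-> ~ heavy (word_of w).
  rewrite not_heavyE; split=> -[w2 w_one]; split=> [x|x y]; have := w2 x.
  - by rewrite occE.
  - by have := w_one x y; rewrite !occE.
  - by rewrite occE.
  - by have := w_one x y; rewrite !occE.
have D_V : (forall w, Omega w -> ~ ~ heavy (word_of w)) -> subvariety D (V_ Omega z).
  by move=> O_heavy; apply: D_sub_V => w /O_heavy; apply: contrapT.
split; split.
- move=> V_fb; apply: contrapT => no_light.
  apply: (not_finitely_based_above_D _ _ V_fb); last exact: V_sub_M.
  by apply: D_V => w Ow w_light; apply: no_light; exists w => //; apply/occ_light.
- by case=> w Ow /occ_light w_light; apply: finitely_based_V Ow w_light.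
- by case=> w Ow /occ_light w_light; apply: D_not_sub_V Ow w_light.
- move=> D_nV; apply: contrapT => no_light; apply: D_nV.
  by apply: D_V => w Ow w_light; apply: no_light; exists w => //; apply/occ_light.
Qed.
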